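(* Let $0<a_{\mathbf K}<c_{\mathbf K}$, $F=(-2c_{\mathbf K},0)$, $F'=(0,0)$, and let the reflection wall be one of the two branches $\mathcal B_{F'}$ or $\mathcal B_F$ of the hyperbola $\frac{(x+c_{\mathbf K})^2}{a_{\mathbf K}^2}-\frac{y^2}{c_{\mathbf K}^2-a_{\mathbf K}^2}=1$. Consider a Kepler billiard orbit with Kepler center $F$ reflected at this wall, whose Kepler ellipses have semi-major axis $a$ and whose second orbital foci lie on the foci-circle $x^2+y^2=R^2$. Then every secant line formed by two consecutive second foci $F_i,F_{i+1}$ of the Kepler ellipses is tangent to the circle (the foci-caustic circle) $$\mathcal C_1:\ (x-x_0)^2+y^2=r_0^2,$$ where, if the wall is $\mathcal B_{F'}$, $$x_0=\frac{c_{\mathbf K}}{2(a_{\mathbf K}^2-c_{\mathbf K}^2)}\bigl[R^2-4(a-a_{\mathbf K})^2\bigr],\qquad r_0=2(a-a_{\mathbf K})-\frac{a_{\mathbf K}}{c_{\mathbf K}}x_0,$$ and, if the wall is $\mathcal B_{F}$, $$x_0=\frac{c_{\mathbf K}}{2(a_{\mathbf K}^2-c_{\mathbf K}^2)}\bigl[R^2-4(a+a_{\mathbf K})^2\bigr],\qquad r_0=2(a+a_{\mathbf K})+\frac{a_{\mathbf K}}{c_{\mathbf K}}x_0.$$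
   Context: Setting: a point particle in the plane moves under an attractive Kepler force with center $F=(-2c_{\mathbf K},0)$ and is reflected elastically (angle of incidence equals angle of reflection, speed preserved) at a wall, which is one branch of the hyperbola with foci $F$ and $F'=(0,0)$ and semi-major axis $a_{\mathbf K}$. $\mathcal B_F$ is the left branch (the one enclosing $F$; its points satisfy $|F'P|-|FP|=2a_{\mathbf K}$) and $\mathcal B_{F'}$ is the right branch (the one enclosing $F'$; its points satisfy $|FP|-|F'P|=2a_{\mathbf K}$). Between reflections the particle moves on a Kepler ellipse having $F$ as one focus. Since the energy is conserved, all these ellipses have the same semi-major axis $a>0$. The other focus of the $i$-th ellipse is called the second (orbital) focus $F_i$; thus the $i$-th ellipse is $\{X: |FX|+|XF_i|=2a\}$. Consecutive ellipses (with second foci $F_i,F_{i+1}$) share the reflection point $P$ on the wall, and their directions at $P$ are related by the reflection law. It is a known first integral of this billiard that all $F_i$ of one orbit lie on a common circle $\mathcal C_0: x^2+y^2=R^2$ centered at $F'$ (the foci-circle), so $R\ge 0$ is a conserved quantity. The secant formed by $F_i,F_{i+1}$ is the line through these two points, when they are distinct. If $r_0=0$ the circle degenerates to its center, and tangency means that the line passes through this center. Only $r_0^2$ enters the equation of $\mathcal C_1$; the radius is $|r_0|$. *)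

(* Defs.v *)
From Stdlib Require Import Reals.
From Coquelicot Require Import Coquelicot.
Open Scope R_scope.

(** Plane geometry *)

Definition pt : Type := (R * R)%type.

Definition vsub (A B : pt) : pt := (fst A - fst B, snd A - snd B).
Definition dot (u v : pt) : R := fst u * fst v + snd u * snd v.
Definition edist (A B : pt) : R := sqrt (dot (vsub B A) (vsub B A)).

Definition circle (C : pt) (r : R) (X : pt) : Prop :=
  (fst X - fst C) ^ 2 + (snd X - snd C) ^ 2 = r ^ 2.

Definition line_through (A B X : pt) : Prop :=
  exists s : R, fst X = fst A + s * (fst B - fst A) /\
                snd X = snd A + s * (snd B - snd A).

(* The line meets the circle in exactly one point.  Only [r ^ 2] matters; for
   [r = 0] the circle is the point [C], and this says that the line passes
   through [C]. *)
Definition tangent (L : pt -> Prop) (C : pt) (r : R) : Prop :=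
  exists! X : pt, L X /\ circle C r X.

(** The wall *)

Definition focus_F (cK : R) : pt := (- (2 * cK), 0).

(* [BF] is the left branch, enclosing the Kepler center [F]; [BF'] is the right
   branch, enclosing the focus [F'] at the origin. *)
Inductive branch : Set := BF | BF'.

Definition on_wall (aK cK : R) (w : branch) (P : pt) : Prop :=
  (fst P + cK) ^ 2 / aK ^ 2 - (snd P) ^ 2 / (cK ^ 2 - aK ^ 2) = 1 /\
  match w with
  | BF => fst P < - cK
  | BF' => - cK < fst P
  end.

(* Half the gradient of the left-hand side of the equation of the hyperbola. *)
Definition wall_normal (aK cK : R) (P : pt) : pt :=
  ((fst P + cK) / aK ^ 2, - (snd P / (cK ^ 2 - aK ^ 2))).

(* Elastic reflection at [P] of the velocity [u]: the normal component is
   reversed and the tangential one is kept. *)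
Definition reflect_velocity (aK cK : R) (P u : pt) : pt :=
  let n := wall_normal aK cK P in
  let k := 2 * (dot u n / dot n n) in
  (fst u - k * fst n, snd u - k * snd n).

(** Kepler billiard orbits *)

(* [q] is a position and [v] its velocity; Newton's equation is
   q'' = - mu (q - F) / |q - F|^3.  The last clause is the usual relation
   E = - mu / (2 a) between the energy and the semi-major axis; it gives [a] a
   meaning also for radial motions, whose ellipse degenerates to a segment.
   Asking for two-sided derivatives at [t0] and [t1] is no restriction, since a
   collision-free Kepler motion extends beyond [t0] and [t1]. *)
Definition kepler_arc (mu a : R) (F : pt) (t0 t1 : R) (q v : R -> pt) : Prop :=
  forall t : R, t0 <= t <= t1 ->
    q t <> F /\
    is_derive (fun s => fst (q s)) t (fst (v t)) /\
    is_derive (fun s => snd (q s)) t (snd (v t)) /\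
    is_derive (fun s => fst (v s)) t
      (- (mu * (fst (q t) - fst F) / edist F (q t) ^ 3)) /\
    is_derive (fun s => snd (v s)) t
      (- (mu * (snd (q t) - snd F) / edist F (q t) ^ 3)) /\
    dot (v t) (v t) / 2 - mu / edist F (q t) = - (mu / (2 * a)).

(* An orbit with [N] reflections, hence [N + 1] Kepler arcs: the [i]-th arc
   [q i], with velocity [v i], is travelled during [t i, t (S i)], and the
   reflection between the arcs [i] and [S i] takes place at time [t (S i)].  The
   orbit may start and end off the wall. *)
Record kepler_billiard_orbit (mu a aK cK : R) (w : branch) (N : nat)
    (t : nat -> R) (q v : nat -> R -> pt) : Prop := {
  kbo_times : forall i : nat, (i <= N)%nat -> t i < t (S i);
  kbo_arcs : forall i : nat, (i <= N)%nat ->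
    kepler_arc mu a (focus_F cK) (t i) (t (S i)) (q i) (v i);
  kbo_free : forall (i : nat) (s : R), (i <= N)%nat ->
    t i < s < t (S i) -> ~ on_wall aK cK w (q i s);
  kbo_bounce : forall i : nat, (i < N)%nat ->
    let P := q i (t (S i)) in
    on_wall aK cK w P /\
    q (S i) (t (S i)) = P /\
    v (S i) (t (S i)) = reflect_velocity aK cK P (v i (t (S i)))
}.

(* [G i] is the second focus of the [i]-th ellipse: the [i]-th arc lies on
   {X : |FX| + |X (G i)| = 2 a}. *)
Definition second_foci (a cK : R) (N : nat) (t : nat -> R)
    (q : nat -> R -> pt) (G : nat -> pt) : Prop :=
  forall (i : nat) (s : R), (i <= N)%nat -> t i <= s <= t (S i) ->
    edist (focus_F cK) (q i s) + edist (q i s) (G i) = 2 * a.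

(** The foci-caustic circle; [rho] is the radius of the foci-circle *)

Definition caustic_x0 (a aK cK rho : R) (w : branch) : R :=
  match w with
  | BF' => cK / (2 * (aK ^ 2 - cK ^ 2)) * (rho ^ 2 - 4 * (a - aK) ^ 2)
  | BF => cK / (2 * (aK ^ 2 - cK ^ 2)) * (rho ^ 2 - 4 * (a + aK) ^ 2)
  end.

Definition caustic_r0 (a aK cK rho : R) (w : branch) : R :=
  match w with
  | BF' => 2 * (a - aK) - aK / cK * caustic_x0 a aK cK rho BF'
  | BF => 2 * (a + aK) + aK / cK * caustic_x0 a aK cK rho BF
  end.

(* Main.v *)
(** The origin [F'] and the reflection point [P] are both equidistant from the
    two consecutive second foci, so the secant is the radical axis of two
    circles: the foci-circle and the circle about [P] of radius [2 a - |FP|].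
    Since [|FP| = |P| + 2 e aK] with [e = 1] on [BF'] and [e = -1] on [BF], and
    since [|P|] is an affine function of the abscissa of [P] on each branch, the
    distance from [(x0, 0)] to this radical axis does not depend on [P]. *)

Require Import Defs.
From Stdlib Require Import Reals Arith Lra.
From Coquelicot Require Import Coquelicot.
Open Scope R_scope.

Lemma edist_sq (A B : pt) :
  edist A B ^ 2 = (fst B - fst A) ^ 2 + (snd B - snd A) ^ 2.
Proof.
  unfold edist, dot, vsub; simpl fst; simpl snd.
  rewrite pow2_sqrt; [ring | apply Rplus_le_le_0_compat; apply Rle_0_sqr].
Qed.

Lemma edist_unique (A B : pt) (d : R) :
  0 <= d -> d ^ 2 = (fst B - fst A) ^ 2 + (snd B - snd A) ^ 2 -> edist A B = d.
Proof.
  intros Hd H.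
  rewrite <- (sqrt_pow2 d Hd), H.
  unfold edist, dot, vsub; simpl fst; simpl snd; f_equal; ring.
Qed.

(** In the plane, [X - A] and [B - A] are parallel as soon as both are orthogonal to the same
    nonzero [n]. This trades the parametric line for a linear equation with normal [n]. *)
Lemma line_through_normal (A B n X : pt) :
  A <> B -> n <> (0, 0) -> dot A n = dot B n ->
  line_through A B X <-> dot X n = dot A n.
Proof.
  destruct A as [a1 a2], B as [b1 b2], n as [n1 n2], X as [x1 x2].
  unfold line_through, dot; simpl; intros HAB Hn E.
  split.
  - intros [s [-> ->]].
    transitivity (a1 * n1 + a2 * n2 +
                  s * ((b1 * n1 + b2 * n2) - (a1 * n1 + a2 * n2)));
      [| rewrite E]; ring.
  - intros HX.
    assert (HD : (b1 - a1) * (b1 - a1) + (b2 - a2) * (b2 - a2) <> 0).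
    { intros H; apply HAB; apply Rplus_sqr_eq_0 in H; f_equal; lra. }
    assert (EB : (b1 - a1) * n1 + (b2 - a2) * n2 = 0) by lra.
    assert (EX : (x1 - a1) * n1 + (x2 - a2) * n2 = 0) by lra.
    (* [cr] is the cross product of [X - A] and [B - A]; each coordinate of [n] times [cr] is a
       combination of [EB] and [EX]. *)
    set (cr := (x1 - a1) * (b2 - a2) - (x2 - a2) * (b1 - a1)).
    assert (Hcr : cr = 0).
    { assert (H1 : n1 * cr = 0).
      { transitivity (((x1 - a1) * n1 + (x2 - a2) * n2) * (b2 - a2) -
                      (x2 - a2) * ((b1 - a1) * n1 + (b2 - a2) * n2)).
        - unfold cr; ring.
        - rewrite EX, EB; ring. }
      assert (H2 : n2 * cr = 0).
      { transitivity ((x1 - a1) * ((b1 - a1) * n1 + (b2 - a2) * n2) -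
                      ((x1 - a1) * n1 + (x2 - a2) * n2) * (b1 - a1)).
        - unfold cr; ring.
        - rewrite EX, EB; ring. }
      destruct (Rmult_integral _ _ H1), (Rmult_integral _ _ H2); try assumption.
      exfalso; apply Hn; f_equal; assumption. }
    set (D := (b1 - a1) * (b1 - a1) + (b2 - a2) * (b2 - a2)) in *.
    set (p := (x1 - a1) * (b1 - a1) + (x2 - a2) * (b2 - a2)).
    (* The parameter is the coefficient of the orthogonal projection of [X - A] on [B - A]; the
       error terms are multiples of [cr]. *)
    exists (p / D); split; apply (Rmult_eq_reg_r D); try exact HD.
    + replace ((a1 + p / D * (b1 - a1)) * D) with (a1 * D + p * (b1 - a1))
        by (field; exact HD).
      transitivity (a1 * D + p * (b1 - a1) + cr * (b2 - a2));
        [unfold D, p, cr | rewrite Hcr]; ring.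
    + replace ((a2 + p / D * (b2 - a2)) * D) with (a2 * D + p * (b2 - a2))
        by (field; exact HD).
      transitivity (a2 * D + p * (b2 - a2) - cr * (b1 - a1));
        [unfold D, p, cr | rewrite Hcr]; ring.
Qed.

(** The last hypothesis says that [C] is at distance [|r|] from the line, cleared of the denominator
    [dot n n]. The foot of the perpendicular is then the only common point, also for [r = 0]. *)
Lemma tangent_of_distance (A B n C : pt) (r : R) :
  A <> B -> n <> (0, 0) -> dot A n = dot B n ->
  (dot A n - dot C n) ^ 2 = r ^ 2 * dot n n ->
  tangent (line_through A B) C r.
Proof.
  intros HAB Hn E Hr.
  assert (HD : dot n n <> 0).
  { destruct n as [n1 n2]; unfold dot; simpl; intros H; apply Hn; apply Rplus_sqr_eq_0 in H; f_equal; lra. }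
  pose proof (fun X => line_through_normal A B n X HAB Hn E) as HL.
  set (k := dot A n) in *; clearbody k.
  destruct n as [n1 n2], C as [c1 c2].
  unfold tangent, circle, dot in *; simpl fst in *; simpl snd in *.
  (* [C + m n] is the foot of the perpendicular from [C] to the line. *)
  set (m := (k - (c1 * n1 + c2 * n2)) / (n1 * n1 + n2 * n2)).
  assert (Hm : m * (n1 * n1 + n2 * n2) = k - (c1 * n1 + c2 * n2))
    by (unfold m; field; exact HD).
  assert (Hmr : m ^ 2 * (n1 * n1 + n2 * n2) = r ^ 2).
  { apply (Rmult_eq_reg_r (n1 * n1 + n2 * n2)); [| exact HD].
    rewrite <- Hr, <- Hm; ring. }
  clearbody m.
  exists (c1 + m * n1, c2 + m * n2); split; [split |].
  - apply HL; simpl; lra.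
  - simpl fst; simpl snd; rewrite <- Hmr; ring.
  - intros [x1 x2] [HX HC]; apply HL in HX; simpl in HX; simpl fst in HC; simpl snd in HC.
    (* Pythagoras: the squared distance from a common point to the foot is
       [r ^ 2 - m ^ 2 * |n| ^ 2], which vanishes by [Hmr]. *)
    assert (H : (x1 - c1 - m * n1) ^ 2 + (x2 - c2 - m * n2) ^ 2 = 0).
    { replace ((x1 - c1 - m * n1) ^ 2 + (x2 - c2 - m * n2) ^ 2) with
        ((x1 - c1) ^ 2 + (x2 - c2) ^ 2
         - 2 * m * ((x1 * n1 + x2 * n2) - (c1 * n1 + c2 * n2))
         + m * (m * (n1 * n1 + n2 * n2))) by ring.
      rewrite HC, HX, <- Hmr, <- Hm; ring. }
    rewrite <- !Rsqr_pow2 in H; apply Rplus_sqr_eq_0 in H; f_equal; lra.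
Qed.

Definition branch_sign (w : branch) : R :=
  match w with BF => -1 | BF' => 1 end.

(** With [X = (x + cK) / aK] and [e] the sign of the branch, the focal radii are
    [|P| = e (cK X - aK)] and [|FP| = e (cK X + aK)]; here [e X >= 1] and [aK < cK] make both
    positive. *)
Lemma wall_focal_distances (aK cK : R) (w : branch) (P : pt) :
  0 < aK < cK -> on_wall aK cK w P ->
  exists d : R, 0 < d /\ d ^ 2 = dot P P /\
    edist (focus_F cK) P = d + 2 * branch_sign w * aK /\
    cK * fst P = branch_sign w * aK * d + aK ^ 2 - cK ^ 2.
Proof.
  destruct P as [x y]; unfold on_wall, dot; simpl fst; simpl snd.
  intros [Ha Hac] [Heq Hw].
  assert (Hb : 0 < cK ^ 2 - aK ^ 2) by nra.
  set (X := (x + cK) / aK).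
  assert (Hx : x = X * aK - cK) by (unfold X; field; lra).
  assert (Hy : y ^ 2 = (X ^ 2 - 1) * (cK ^ 2 - aK ^ 2)).
  { replace (X ^ 2) with ((x + cK) ^ 2 / aK ^ 2) by (unfold X; field; lra).
    replace ((x + cK) ^ 2 / aK ^ 2 - 1) with (y ^ 2 / (cK ^ 2 - aK ^ 2)) by lra.
    field; lra. }
  clearbody X; subst x; clear Heq.
  assert (HX : 1 <= X ^ 2) by nra.
  assert (HsX : 1 <= branch_sign w * X).
  { destruct w; simpl.
    - assert (X < 0) by nra; nra.
    - assert (0 < X) by nra; nra. }
  assert (He : branch_sign w ^ 2 = 1) by (destruct w; simpl; ring).
  set (e := branch_sign w) in *; clearbody e.
  assert (Hce : cK <= cK * (e * X)) by nra.
  exists (cK * (e * X) - e * aK).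
  assert (Hae : - aK <= e * aK <= aK) by (assert (-1 <= e <= 1) by nra; nra).
  split; [lra |]; split; [| split].
  - replace ((cK * (e * X) - e * aK) ^ 2) with (e ^ 2 * (cK * X - aK) ^ 2) by ring.
    rewrite He; nra.
  - apply edist_unique; simpl fst; simpl snd; [lra |].
    replace ((cK * (e * X) - e * aK + 2 * e * aK) ^ 2)
      with (e ^ 2 * (cK * X + aK) ^ 2) by ring.
    rewrite He; nra.
  - replace (e * aK * (cK * (e * X) - e * aK))
      with (e ^ 2 * (aK * (cK * X - aK))) by ring.
    rewrite He; ring.
Qed.

Lemma caustic_x0_sign (a aK cK rho : R) (w : branch) :
  0 < aK < cK ->
  2 * (aK ^ 2 - cK ^ 2) * caustic_x0 a aK cK rho w =
  cK * (rho ^ 2 - 4 * (a - branch_sign w * aK) ^ 2).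
Proof.
  intros H; destruct w; simpl; field; nra.
Qed.

Lemma caustic_r0_sign (a aK cK rho : R) (w : branch) :
  caustic_r0 a aK cK rho w =
  2 * (a - branch_sign w * aK) -
  branch_sign w * aK / cK * caustic_x0 a aK cK rho w.
Proof.
  destruct w; unfold caustic_r0, branch_sign, Rdiv; ring.
Qed.

Lemma secant_tangent_caustic (aK cK a rho : R) (w : branch) (P A B : pt) :
  0 < aK < cK -> on_wall aK cK w P ->
  edist (focus_F cK) P + edist P A = 2 * a ->
  edist (focus_F cK) P + edist P B = 2 * a ->
  circle (0, 0) rho A -> circle (0, 0) rho B -> A <> B ->
  tangent (line_through A B)
    (caustic_x0 a aK cK rho w, 0) (caustic_r0 a aK cK rho w).
Proof.
  intros HK HP HA HB CA CB HAB.
  destruct (wall_focal_distances aK cK w P HK HP) as (d & Hd & Hd2 & HF & Hx).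
  pose proof (caustic_x0_sign a aK cK rho w HK) as Hx0.
  rewrite caustic_r0_sign.
  set (x0 := caustic_x0 a aK cK rho w) in *; clearbody x0.
  set (e := branch_sign w) in *; clearbody e.
  (* Expanding [|PX| ^ 2 = (2 (a - e aK) - d) ^ 2] with [|X| = rho], the term [d ^ 2 = |P| ^ 2]
     cancels. What remains is linear in [X], with normal vector [P]. *)
  assert (radical : forall X : pt, edist (focus_F cK) P + edist P X = 2 * a ->
    circle (0, 0) rho X ->
    2 * dot X P = rho ^ 2 - 4 * (a - e * aK) ^ 2 + 4 * (a - e * aK) * d).
  { intros X HX CX; pose proof (edist_sq P X) as E.
    replace (edist P X) with (2 * (a - e * aK) - d) in E by lra.
    unfold circle in CX; unfold dot in *; simpl fst in CX; simpl snd in CX; nra. }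
  pose proof (radical A HA CA) as RA; pose proof (radical B HB CB) as RB.
  apply (tangent_of_distance A B P); [exact HAB | | lra |].
  - intros ->; unfold dot in Hd2; simpl in Hd2; nra.
  - rewrite <- Hd2.
    assert (HC : dot (x0, 0) P = x0 / cK * (cK * fst P))
      by (unfold dot; simpl; field; lra).
    (* This is how [x0] is chosen: the terms free of [d] cancel in [dot A P - dot (x0, 0) P],
       leaving [d] times the radius. *)
    assert (Hc : rho ^ 2 - 4 * (a - e * aK) ^ 2 = 2 * (x0 / cK) * (aK ^ 2 - cK ^ 2)).
    { apply (Rmult_eq_reg_l cK); [rewrite <- Hx0; field |]; lra. }
    rewrite HC, Hx.
    replace (dot A P) with
      ((x0 / cK) * (aK ^ 2 - cK ^ 2) + 2 * (a - e * aK) * d) by lra.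
    unfold Rdiv; ring.
Qed.

Theorem theorem3p1 :
  forall (aK cK : R) (w : branch) (mu a rho : R) (N : nat)
         (t : nat -> R) (q v : nat -> R -> pt) (G : nat -> pt),
    0 < aK < cK ->
    0 < mu ->
    0 < a ->
    0 <= rho ->
    kepler_billiard_orbit mu a aK cK w N t q v ->
    second_foci a cK N t q G ->
    (forall i : nat, (i <= N)%nat -> circle (0, 0) rho (G i)) ->
    forall i : nat, (i < N)%nat -> G i <> G (S i) ->
      tangent (line_through (G i) (G (S i)))
        (caustic_x0 a aK cK rho w, 0) (caustic_r0 a aK cK rho w).
Proof.
  intros aK cK w mu a rho N t q v G HK _ _ _ Horb HG Hcirc i Hi Hne.
  assert (HiN : (i <= N)%nat) by (apply Nat.lt_le_incl; exact Hi).
  destruct (kbo_bounce _ _ _ _ _ _ _ _ _ Horb i Hi) as (HP & Hq & _).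
  pose proof (kbo_times _ _ _ _ _ _ _ _ _ Horb i HiN) as T0.
  pose proof (kbo_times _ _ _ _ _ _ _ _ _ Horb (S i) Hi) as T1.
  (* The bounce point ends arc [i] and starts arc [S i], so it lies on both ellipses. *)
  apply (secant_tangent_caustic aK cK a rho w (q i (t (S i)))); auto.
  - apply HG; [exact HiN | lra].
  - rewrite <- Hq; apply HG; [exact Hi | lra].
Qed.
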